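(* Let $k$ be a field of characteristic $p>0$ and let $H$ be a finite-dimensional pointed rank one Hopf algebra over $k$, generated as an algebra by $H_1$, of third type, with skew point $a$ and $x\in P_{a,1}\setminus H_0$ satisfying $axa^{-1}=x+(a-1)$. Then the conjugation action of $G(H)$ is given by $gxg^{-1}=x+c(g)(a-1)$ for all $g\in G(H)$, where $c:G(H)\to(k,+)$ is a group homomorphism.
   Context: For a finite-dimensional Hopf algebra $H$ over $k$: $G(H)$ is the group of group-like elements; the coradical $H_0$ is the sum of the simple subcoalgebras; $H_1=\Delta^{-1}(H\otimes H_0+H_0\otimes H)$. $H$ is pointed if all simple subcoalgebras are one-dimensional, so that $H_0=kG(H)$. For $g,h\in G(H)$, $P_{g,h}=\{c\in H:\Delta(c)=c\otimes g+h\otimes c\}$. An element $a\in G(H)$ is a skew point if $P_{a,1}\setminus H_0\neq\emptyset$. A pointed $H$ has rank $t$ if $\dim_k k\otimes_{H_0}H_1=t+1$ ($k$ trivial via the counit). A pointed rank one Hopf algebra has exactly one skew point $a$, and it is central in $G(H)$. $H$ is of third type if $a\ne1$ and there is $x\in P_{a,1}\setminus H_0$ with $axa^{-1}=x+(a-1)$. *)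

(* Defs.v *)
From HB Require Import structures.
From mathcomp Require Import all_boot all_order all_algebra all_field.
From mathcomp Require Import boolp.

Set Implicit Arguments.
Unset Strict Implicit.
Unset Printing Implicit Defensive.

Import GRing.Theory VectorInternalTheory.
Local Open Scope ring_scope.

(* Tensor products of finite-dimensional vector spaces, modelled by matrices  *)
(* of coordinates: the entry (i, j) of t is the coefficient of t on the       *)
(* tensor of the basis vectors tbase i and tbase j. The universal property    *)
(* is tliftE and tens_ext below.                                              *)
Definition tens (k : fieldType) (V W : vectType k) : vectType k :=
  'M[k]_(dim V, dim W).

Definition tensor (k : fieldType) (V W : vectType k) (v : V) (w : W)
  : tens V W := ((v2r v)^T *m v2r w)%R.

Reserved Notation "v \ox w" (at level 40, left associativity).
Notation "v \ox w" := (tensor v w) : ring_scope.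

Definition tbase (k : fieldType) (V : vectType k) (i : 'I_(dim V)) : V :=
  r2v (delta_mx 0 i).

(* The linear map sending v \ox w to f v w, for bilinear f. *)
Definition tlift (k : fieldType) (V W U : vectType k) (f : V -> W -> U)
    (t : tens V W) : U :=
  \sum_(i < dim V) \sum_(j < dim W)
    (t : 'M[k]_(dim V, dim W)) i j *: f (tbase i) (tbase j).

Definition tmap (k : fieldType) (V W V' W' : vectType k)
    (f : V -> V') (g : W -> W') (t : tens V W) : tens V' W' :=
  tlift (fun v w => f v \ox g w) t.

(* (v \ox w) \ox u |-> v \ox (w \ox u) *)
Definition tassoc (k : fieldType) (V W U : vectType k)
    (t : tens (tens V W) U) : tens V (tens W U) :=
  tlift (fun (s : tens V W) u => tlift (fun v w => v \ox (w \ox u)) s) t.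

(* (a \ox b) * (c \ox d) = (a * c) \ox (b * d) *)
Definition tmul (k : fieldType) (A B : falgType k) (s t : tens A B)
  : tens A B :=
  tlift (fun a b => tlift (fun c d => (a * c) \ox (b * d)) t) s.

Section TensorTheory.
Variable k : fieldType.
Implicit Types V W U : vectType k.

Lemma tbase_sum V (v : V) : v = \sum_i v2r v 0 i *: tbase i.
Proof.
apply: (can_inj v2rK); rewrite linear_sum {1}[v2r v]row_sum_delta.
by apply: eq_bigr => i _; rewrite linearZ /= r2vK.
Qed.

Lemma tensorE V W (v : V) (w : W) i j :
  (v \ox w : 'M_(_, _)) i j = v2r v 0 i * v2r w 0 j.
Proof. by rewrite !mxE big_ord1 mxE. Qed.

Lemma tensor_linearl V W (w : W) : linear (fun v : V => v \ox w).
Proof.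
by move=> c u v; rewrite /tensor !linearP /= mulmxDl scalemxAl.
Qed.

Lemma tensor_linearr V W (v : V) : linear (fun w : W => v \ox w).
Proof. by move=> c u w; rewrite /tensor !linearP. Qed.

HB.instance Definition _ V W := bilinear_isBilinear.Build k V W (tens V W)
  *:%R *:%R (@tensor k V W) (@tensor_linearl V W, @tensor_linearr V W).

Lemma tlift_linear V W U (f : V -> W -> U) : linear (tlift f).
Proof.
move=> c s t; rewrite /tlift scaler_sumr -big_split; apply: eq_bigr => i _ /=.
rewrite scaler_sumr -big_split; apply: eq_bigr => j _ /=.
by rewrite !mxE scalerDl scalerA.
Qed.

HB.instance Definition _ V W U (f : V -> W -> U) :=
  GRing.isLinear.Build k (tens V W) U *:%R (tlift f) (tlift_linear f).

Lemma tliftE V W U (f : V -> W -> U) (v : V) (w : W) :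
    (forall w, linear (f^~ w)) -> (forall v, linear (f v)) ->
  tlift f (v \ox w) = f v w.
Proof.
move=> fl fr.
pose gl w := HB.pack_for {linear V -> U} (f^~ w)
  (GRing.isLinear.Build k V U *:%R (f^~ w) (fl w)).
pose gr v := HB.pack_for {linear W -> U} (f v)
  (GRing.isLinear.Build k W U *:%R (f v) (fr v)).
rewrite {2}[v]tbase_sum -[f _ w]/(gl w _) linear_sum; apply: eq_bigr => i _.
rewrite linearZ /= {2}[w]tbase_sum -[f _ _]/(gr _ _) linear_sum scaler_sumr.
by apply: eq_bigr => j _; rewrite linearZ /= scalerA tensorE.
Qed.

Lemma tens_sum V W (t : tens V W) :
  t = \sum_i \sum_j (t : 'M[k]_(_, _)) i j *: (tbase i \ox tbase j).
Proof.
rewrite {1}[t]matrix_sum_delta; apply: eq_bigr => i _; apply: eq_bigr => j _.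
congr (_ *: _); apply/matrixP => i' j'; rewrite tensorE !r2vK !mxE /=.
by case: (i' == i); case: (j' == j); rewrite ?mulr1 ?mulr0.
Qed.

Lemma tens_ext V W U (f g : {linear tens V W -> U}) :
  (forall v w, f (v \ox w) = g (v \ox w)) -> f =1 g.
Proof.
move=> fg t; rewrite [t]tens_sum !linear_sum; apply: eq_bigr => i _.
by rewrite !linear_sum; apply: eq_bigr => j _; rewrite !linearZ /= fg.
Qed.

Lemma tmulE (A B : falgType k) (a c : A) (b d : B) :
  tmul (a \ox b) (c \ox d) = (a * c) \ox (b * d).
Proof.
have inner (a' : A) (b' : B) :
    tlift (fun c d => (a' * c) \ox (b' * d)) (c \ox d)
    = (a' * c) \ox (b' * d).
  rewrite tliftE // => [w|v] l x y.
    by rewrite mulrDr -scalerAr tensor_linearl.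
  by rewrite mulrDr -scalerAr tensor_linearr.
rewrite /tmul tliftE => [|w|v]; first by rewrite inner.
  by move=> l x y; rewrite !inner mulrDl -scalerAl tensor_linearl.
by move=> l x y; rewrite !inner mulrDl -scalerAl tensor_linearr.
Qed.

Lemma tmul_linear (A B : falgType k) (s : tens A B) : linear (tmul s).
Proof.
pose L i j := tlift (fun (c : A) (d : B) => (tbase i * c) \ox (tbase j * d)).
have E u : tmul s u =
  \sum_i \sum_j (s : 'M[k]_(dim A, dim B)) i j *: L i j u by [].
move=> c t u; rewrite !E scaler_sumr -big_split; apply: eq_bigr => i _ /=.
rewrite scaler_sumr -big_split; apply: eq_bigr => j _ /=.
by rewrite /L linearP scalerDr !scalerA mulrC.
Qed.

HB.instance Definition _ (A B : falgType k) (s : tens A B) :=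
  GRing.isLinear.Build k (tens A B) (tens A B) *:%R (tmul s) (tmul_linear s).

End TensorTheory.

(* Linear span of an arbitrary, possibly infinite, set of vectors. *)
Section SpanSet.
Variables (k : fieldType) (V : vectType k).

Lemma span_set_ex (A : V -> Prop) :
  exists U : {vspace V}, (forall v, A v -> v \in U) /\
    (forall W : {vspace V}, (forall v, A v -> v \in W) -> (U <= W)%VS).
Proof.
suff: forall n (U : {vspace V}), (\dim {:V} - \dim U <= n)%N ->
    (forall W : {vspace V}, (forall v, A v -> v \in W) -> (U <= W)%VS) ->
    exists U : {vspace V}, (forall v, A v -> v \in U) /\
    (forall W : {vspace V}, (forall v, A v -> v \in W) -> (U <= W)%VS).
  by move/(_ _ 0%VS (leqnn _)); apply=> W _; apply: sub0v.
elim=> [|n IHn] U leUn minU.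
  exists U; split=> // v _; suff ->: U = fullv by rewrite memvf.
  by apply/eqP; rewrite eqEdim subvf -subn_eq0 -leqn0.
have [AU | /existsNP[v /not_implyP[Av vU]]] :=
  pselect (forall v, A v -> v \in U); first by exists U.
apply: (IHn (U + <[v]>)%VS) => [|W AW]; last first.
  by rewrite subv_add minU //= -memvE AW.
rewrite -ltnS; apply: leq_trans leUn.
have ltU : (\dim U < \dim (U + <[v]>))%N.
  rewrite ltn_neqAle dimvS ?addvSl // andbT; apply/negP => eqU; apply: vU.
  have /eqP -> : U == (U + <[v]>)%VS by rewrite eqEdim addvSl (eqP eqU) /=.
  by rewrite memvE addvSr.
by apply: ltn_sub2l => //; apply: leq_trans ltU (dimvS (subvf _)).
Qed.

Definition span_set (A : V -> Prop) : {vspace V} := projT1 (cid (span_set_ex A)).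

Lemma mem_span_set (A : V -> Prop) v : A v -> v \in span_set A.
Proof. by rewrite /span_set; case: cid => /= U [AU _]; apply: AU. Qed.

Lemma span_set_sub (A : V -> Prop) (W : {vspace V}) :
  (forall v, A v -> v \in W) -> (span_set A <= W)%VS.
Proof. by rewrite /span_set; case: cid => /= U [_ minU]; apply: minU. Qed.

End SpanSet.

Definition tensv (k : fieldType) (V W : vectType k) (A : {vspace V})
    (B : {vspace W}) : {vspace tens V W} :=
  span_set (fun t => exists v w, [/\ v \in A, w \in B & t = v \ox w]).

HB.mixin Record Falgebra_isHopf (k : fieldType) H of Falgebra k H := {
  comul : 'Hom(H, tens H H);
  counit : 'Hom(H, k^o);
  antipode : 'Hom(H, H);
  comulA : forall x : H,
    tassoc (tmap comul id (comul x)) = tmap id comul (comul x);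
  counitl : forall x : H, tlift (fun u v => counit u *: v) (comul x) = x;
  counitr : forall x : H, tlift (fun u v => counit v *: u) (comul x) = x;
  comul1 : comul 1 = 1 \ox 1;
  comulM : forall x y : H, comul (x * y) = tmul (comul x) (comul y);
  counit1 : counit 1 = 1;
  counitM : forall x y : H, counit (x * y) = counit x * counit y;
  antipodel : forall x : H,
    tlift (fun u v => antipode u * v) (comul x) = counit x *: 1;
  antipoder : forall x : H,
    tlift (fun u v => u * antipode v) (comul x) = counit x *: 1
}.

#[short(type="hopfAlgType")]
HB.structure Definition HopfAlgebra (k : fieldType) :=
  { H of Falgebra k H & Falgebra_isHopf k H }.

Definition grouplike (k : fieldType) (H : hopfAlgType k) : {pred H} :=
  [pred g : H | (g != 0) && (comul g == g \ox g)].
Arguments grouplike {k} H _.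

Definition subcoalgebra (k : fieldType) (H : hopfAlgType k) (C : {vspace H}) :=
  (comul @: C <= tensv C C)%VS.

Definition simple_subcoalgebra (k : fieldType) (H : hopfAlgType k)
    (C : {vspace H}) : Prop :=
  [/\ subcoalgebra C, C != 0%VS &
      forall D : {vspace H}, subcoalgebra D -> (D <= C)%VS ->
        D = 0%VS \/ D = C].

(* The sum of a possibly infinite family of subspaces is the span of its union. *)
Definition coradical (k : fieldType) (H : hopfAlgType k) : {vspace H} :=
  span_set (fun v => exists2 C : {vspace H}, simple_subcoalgebra C & v \in C).

(* The second term of the coradical filtration, usually written H_1. *)
Definition coradical1 (k : fieldType) (H : hopfAlgType k) : {vspace H} :=
  (comul @^-1: (tensv fullv (coradical H) + tensv (coradical H) fullv))%VS.

Definition pointed (k : fieldType) (H : hopfAlgType k) : Prop :=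
  forall C : {vspace H}, simple_subcoalgebra C -> \dim C = 1%N.

Definition skew_primitive (k : fieldType) (H : hopfAlgType k) (g h : H)
  : {pred H} := [pred c : H | comul c == c \ox g + h \ox c].

Definition skew_point (k : fieldType) (H : hopfAlgType k) (a : H) : Prop :=
  a \in grouplike H /\
  exists2 x : H, x \in skew_primitive a 1 & x \notin coradical H.

(* For a subspace M stable under left multiplication by a subalgebra B, the   *)
(* space k (x)_B M is the quotient of k (x)_k M by the span of the elements   *)
(* (l . b) (x) m - l (x) (b m), where l . b = l * counit b. Quotients of      *)
(* subspaces are represented by complements.                                  *)
Definition balancing_relations (k : fieldType) (H : hopfAlgType k)
    (B M : {vspace H}) : {vspace tens k^o H} :=
  span_set (fun t => exists (l : k^o) (b m : H), [/\ b \in B, m \in M &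
    t = (l * counit b : k^o) \ox m - l \ox (b * m)]).

Definition trivial_tensor_over (k : fieldType) (H : hopfAlgType k)
    (B M : {vspace H}) : {vspace tens k^o H} :=
  (tensv {:k^o} M :\: balancing_relations B M)%VS.

Definition has_rank (k : fieldType) (H : hopfAlgType k) (t : nat) : Prop :=
  \dim (trivial_tensor_over (coradical H) (coradical1 H)) = t.+1.

Definition generated_by_coradical1 (k : fieldType) (H : hopfAlgType k) : Prop :=
  agenv (coradical1 H) = fullv.

(* H is of third type, a being its skew point. *)
Definition third_type (k : fieldType) (H : hopfAlgType k) (a : H) : Prop :=
  [/\ skew_point a, a != 1 &
      exists x : H, [/\ x \in skew_primitive a 1, x \notin coradical H &
                        a * x * a^-1 = x + (a - 1)]].

(* The group-like elements form a group: a subgroup of the units of H. *)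
Section Grouplike.
Variables (k : fieldType) (H : hopfAlgType k).

Lemma grouplikeP (g : H) :
  reflect (g != 0 /\ comul g = g \ox g) (g \in grouplike H).
Proof. by apply: (iffP andP) => -[? /eqP ?]. Qed.

Lemma grouplike_counit (g : H) : g \in grouplike H -> counit g = 1 :> k.
Proof.
move=> /grouplikeP[g0 gg]; have := counitl g; rewrite gg tliftE => [|w|v].
- move=> e; apply/eqP; rewrite -subr_eq0.
  have : (counit g - 1 : k) *: g == 0 by rewrite scalerBl e scale1r subrr.
  by rewrite scaler_eq0 (negPf g0) orbF.
- by move=> l x y; rewrite linearP /= scalerDl scalerA.
- by move=> l x y; rewrite scalerDr !scalerA mulrC.
Qed.

Lemma grouplike_unit (g : H) : g \in grouplike H -> g \is a GRing.unit.
Proof.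
move=> gG; have e1 := grouplike_counit gG; have /grouplikeP[_ gg] := gG.
have := antipodel g; rewrite gg tliftE ?e1 ?scale1r => [Sg|w|v]; last 2 first.
- by move=> l x y; rewrite linearP /= mulrDl scalerAl.
- by move=> l x y; rewrite mulrDr scalerAr.
have := antipoder g; rewrite gg tliftE ?e1 ?scale1r => [gS|w|v]; last 2 first.
- by move=> l x y; rewrite mulrDl scalerAl.
- by move=> l x y; rewrite linearP /= mulrDr scalerAr.
by apply/unitrP; exists (antipode g).
Qed.

Lemma grouplike1 : 1 \in grouplike H.
Proof. by apply/grouplikeP; rewrite oner_neq0 comul1. Qed.

Lemma grouplikeM (g h : H) :
  g \in grouplike H -> h \in grouplike H -> g * h \in grouplike H.
Proof.
move=> gG hG; have gU := grouplike_unit gG; apply/grouplikeP.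
have [/grouplikeP[_ gg] /grouplikeP[h0 hh]] := (gG, hG).
split; last by rewrite comulM gg hh tmulE.
by apply: contraNneq h0 => gh0; rewrite -(mulKr gU h) gh0 mulr0.
Qed.

Lemma grouplikeV (g : H) : g \in grouplike H -> g^-1 \in grouplike H.
Proof.
move=> gG; have gU := grouplike_unit gG.
apply/grouplikeP; split; first by apply: contraTneq gU; rewrite -unitrV => ->; rewrite unitr0.
have /grouplikeP[_ gg] := gG.
have mK t : tmul (g^-1 \ox g^-1) (tmul (g \ox g) t) = t.
  rewrite -[LHS]/((tmul (g^-1 \ox g^-1) \o tmul (g \ox g)) t) -[RHS]/(idfun t).
  by apply: tens_ext => v w; rewrite /= !tmulE !mulKr.
by rewrite -[LHS]mK -gg -comulM mulrV // comul1 tmulE !mulr1.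
Qed.

Lemma grouplike_divr_closed : divr_closed (grouplike H).
Proof.
by split=> [|g h gG hG]; [apply: grouplike1 | apply/grouplikeM/grouplikeV].
Qed.

End Grouplike.

(* Main.v *)
Require Import Defs.
From HB Require Import structures.
From mathcomp Require Import all_boot all_order all_algebra all_field.
From mathcomp Require Import boolp.

Set Implicit Arguments.
Unset Strict Implicit.
Unset Printing Implicit Defensive.

Import GRing.Theory VectorInternalTheory.
Local Open Scope ring_scope.

(** Conjugation by a group-like element g sends the skew primitive x, for the
    skew point a, to a skew primitive y for the group-like element b equal to
    g a g^-1. Everything rests on the rank one condition forcing b = a and
    y = r x + c (a - 1).

    Write H0 for the coradical, which is the span of the group-like elements
    because H is pointed, and H1 for the next term of the coradical filtration.
    The space k (x)_H0 H1 is the quotient of H1 by the span of the elements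
    counit h m - h m. Modulo H0, the comultiplication grades H1 on the left by
    the group-like elements, and left multiplication by g shifts this grading
    by g. Hence the quotient retains a full copy of the part of H1/H0 of
    degree 1, in which all elements of P_{b,1} lie, besides the class of 1.
    The map [untwist], which moves each homogeneous part back to degree 1, is
    the formula behind this: modulo H0 it is invariant under multiplication by
    group-like elements ([untwist_grouplikeM]) and it fixes P_{b,1}
    ([untwist_skew_primitive]). So if x and y were independent modulo H0, then
    1, x and y would be independent in k (x)_H0 H1, which has dimension 2; this
    is [rank1_skew_primitive].

    Now write y = r x + h with h in H0. Applying the comultiplication and
    killing H0 in the left factor compares r x (x) b with r x (x) a modulo H0,
    so b = a. Then h is itself skew primitive, and since H0 is cocommutative
    its defining equation reads h (x) (a - 1) = (a - 1) (x) h, that is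
    h = c (a - 1) ([rank1_skew_primitive_decomp]).

    Finally g commutes with a, so conjugating a x a^-1 = x + (a - 1) by g gives
    the same relation for y, which forces r = 1 because a != 1. Comparing the
    actions of g h and of g after h shows that c is additive. *)

(** * Tensor products of vector spaces *)

Section Tensors.
Variable k : fieldType.
Implicit Types V W U : vectType k.

Lemma tensorDl V W (v v' : V) (w : W) : (v + v') \ox w = v \ox w + v' \ox w.
Proof. by rewrite linearDl. Qed.

Lemma tensorDr V W (v : V) (w w' : W) : v \ox (w + w') = v \ox w + v \ox w'.
Proof. by rewrite linearDr. Qed.

Lemma tensorBr V W (v : V) (w w' : W) : v \ox (w - w') = v \ox w - v \ox w'.
Proof. by rewrite linearBr. Qed.

Lemma tensorBl V W (v v' : V) (w : W) : (v - v') \ox w = v \ox w - v' \ox w.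
Proof. by rewrite linearBl. Qed.

Lemma tensorZl V W l (v : V) (w : W) : (l *: v) \ox w = l *: (v \ox w).
Proof. by rewrite linearZl_LR. Qed.

Lemma tensorZr V W l (v : V) (w : W) : v \ox (l *: w) = l *: (v \ox w).
Proof. by rewrite linearZr_LR. Qed.

Lemma tensor0l V W (w : W) : (0 : V) \ox w = 0.
Proof. by rewrite linear0l. Qed.

Lemma coord_neq0 V (v : V) : v != 0 -> exists i, v2r v 0 i != 0.
Proof.
move=> v0; have /existsP[i vi] : [exists i, v2r v 0 i != 0].
  apply: contraNT v0; rewrite negb_exists => /forallP v0.
  apply/eqP; apply: (can_inj v2rK); rewrite linear0.
  by apply/rowP => i; rewrite mxE; have /negPn/eqP := v0 i.
by exists i.
Qed.

Lemma tensor_eq0 V W (v : V) (w : W) : v \ox w = 0 -> v != 0 -> w = 0.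
Proof.
move=> vw0 /coord_neq0[i vi]; apply: (can_inj v2rK).
rewrite linear0; apply/rowP => j; rewrite mxE.
have := tensorE v w i j; rewrite vw0 mxE => /esym/eqP.
by rewrite mulf_eq0 (negPf vi) => /eqP.
Qed.

(** Comparing coordinates, the matrix of v \ox w being symmetric makes v and w
    proportional. *)
Lemma tensor_comm_prop V (v w : V) :
  v \ox w = w \ox v -> w != 0 -> exists c, v = c *: w.
Proof.
move=> vw /coord_neq0[j wj].
exists (v2r v 0 j / v2r w 0 j).
apply: (can_inj v2rK); rewrite linearZ.
apply/rowP => i; rewrite mxE; apply: (mulIf wj).
rewrite -tensorE vw tensorE mulrAC mulfVK // mulrC //.
Qed.

Lemma mem_tensv V W (A : {vspace V}) (B : {vspace W}) v w :
  v \in A -> w \in B -> v \ox w \in tensv A B.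
Proof. by move=> vA wB; apply: mem_span_set; exists v, w. Qed.

Lemma tensv_sub V W (A : {vspace V}) (B : {vspace W}) (U : {vspace tens V W}) :
  {in A & B, forall v w, v \ox w \in U} -> (tensv A B <= U)%VS.
Proof.
by move=> ABU; apply: span_set_sub => t [v [w [vA wB ->]]]; apply: ABU.
Qed.

Lemma tmulDl (A B : falgType k) (s s' t : tens A B) :
  tmul (s + s') t = tmul s t + tmul s' t.
Proof. by rewrite /tmul linearD. Qed.

Definition tswap V W : 'Hom(tens V W, tens W V) :=
  linfun (tlift (fun v w => w \ox v)).

Lemma tswapE V W (v : V) (w : W) : tswap V W (v \ox w) = w \ox v.
Proof.
by rewrite lfunE /= tliftE => [//|u|u] l y z;
  rewrite ?(tensorDl, tensorDr) ?(tensorZl, tensorZr).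
Qed.

End Tensors.

(** * The coradical of a pointed Hopf algebra *)

Section Pointed.
Variables (k : fieldType) (H : hopfAlgType k).
Implicit Types (g h a b : H).
Local Notation H0 := (coradical H).
Local Notation H1 := (coradical1 H).

Lemma antipode_grouplike g : g \in grouplike H -> antipode g = g^-1.
Proof.
move=> gG; have gU := grouplike_unit gG; have e1 := grouplike_counit gG.
have /grouplikeP[_ gg] := gG; have := antipodel g.
rewrite gg tliftE ?e1 ?scale1r => [Sg|w|v].
- by apply: (mulIr gU); rewrite Sg mulVr.
- by move=> l x y; rewrite linearP /= mulrDl scalerAl.
- by move=> l x y; rewrite mulrDr scalerAr.
Qed.

(** A group-like element spans a subcoalgebra, which is simple since it has
    dimension one. *)
Lemma grouplike_coradical g : g \in grouplike H -> g \in H0.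
Proof.
move=> /grouplikeP[g0 gg]; apply: mem_span_set; exists <[g]>%VS; last first.
  exact: memv_line.
split=> [||D _ Dg].
- apply/subvP => _ /memv_imgP[_ /vlineP[l ->] ->].
  by rewrite linearZ /= gg memvZ // mem_tensv ?memv_line.
- by apply: contraNneq g0 => g0; rewrite -memv0 -g0 memv_line.
- have [->|D0] := eqVneq D 0%VS; first by left.
  right; apply/eqP; rewrite eqEdim Dg dim_vline g0.
  by rewrite lt0n dimv_eq0 D0.
Qed.

Lemma skew_primitive_counit g h x : g \in grouplike H -> h \in grouplike H ->
  x \in skew_primitive g h -> counit x = 0 :> k.
Proof.
move=> gG hG /eqP xs; have := congr1 counit (counitl x).
rewrite xs linearD /= !tliftE => [|w l y z|v l y z|w l y z|v l y z];
  try by rewrite ?linearP /= ?scalerDr ?scalerDl ?scalerA // mulrC.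
rewrite linearD !linearZ /= (grouplike_counit gG) (grouplike_counit hG) scale1r.
by rewrite [_ *: _]mulr1 => /(canRL (addrK _)); rewrite subrr.
Qed.

Lemma skew_primitive_conj g b y : g \in grouplike H ->
  y \in skew_primitive b 1 -> g * y * g^-1 \in skew_primitive (g * b * g^-1) 1.
Proof.
move=> gG /eqP ys; have gU := grouplike_unit gG; apply/eqP.
have /grouplikeP[_ gg] := gG; have /grouplikeP[_ ggV] := grouplikeV gG.
by rewrite !comulM ys gg ggV linearD /= !tmulE tmulDl !tmulE mulr1 mulrV.
Qed.

Hypothesis ptd : pointed H.

(** A one-dimensional subcoalgebra spanned by w has comul w = l (w \ox w) with
    l nonzero by the counit axiom, so that l w is group-like. Thus H0 is the
    span of the group-like elements; the next two lemmas are the forms in which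
    this is used, to reduce a linear assertion on H0 to group-like elements. *)
Lemma pointed_coradical_sub (W : {vspace H}) :
  {subset grouplike H <= W} -> (H0 <= W)%VS.
Proof.
move=> GW; apply: span_set_sub => v [C Cs vC]; have [CC C0 _] := Cs.
have dimC := ptd Cs; have w0 : vpick C != 0 by rewrite vpick0.
have Cline u : u \in C -> exists l, u = l *: vpick C.
  have /eqP eqC : <[vpick C]>%VS == C.
    by rewrite eqEdim -memvE memv_pick dimC dim_vline w0.
  by rewrite -{1}eqC => /vlineP.
set w := vpick C in w0 Cline; have [l wl] : exists l, comul w = l *: (w \ox w).
  apply/vlineP; apply: (subvP _ _ (memv_img comul (memv_pick C))).
  apply: subv_trans CC _; apply: tensv_sub => _ _ /Cline[l ->] /Cline[l' ->].
  by rewrite tensorZl tensorZr !memvZ // memv_line.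
have l0 : l != 0.
  apply: contraNneq w0 => l0; have := counitl w.
  by rewrite wl l0 scale0r linear0 => <-.
have : l *: w \in grouplike H.
  apply/grouplikeP; split; first by rewrite scaler_eq0 negb_or l0.
  by rewrite linearZ /= wl tensorZl tensorZr.
move/GW => lw; have [c ->] := Cline v vC.
by rewrite -[w](scalerK l0); apply/memvZ/memvZ.
Qed.

Lemma coradical_linear_eq (V : vectType k) (f f' : {linear H -> V}) :
  {in grouplike H, f =1 f'} -> {in H0, f =1 f'}.
Proof.
move=> ff' h hH0; have: (H0 <= lker (linfun f - linfun f'))%VS.
  apply: pointed_coradical_sub => g gG.
  by rewrite memv_ker add_lfunE opp_lfunE !lfunE ff' // subrr.
move/subvP/(_ _ hH0); rewrite memv_ker add_lfunE opp_lfunE !lfunE subr_eq0.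
by move/eqP.
Qed.

Lemma coradical_linear_mem (V : vectType k) (f : {linear H -> V})
    (W : {vspace V}) :
  {in grouplike H, forall g, f g \in W} -> {in H0, forall h, f h \in W}.
Proof.
move=> fW h hH0; have: (H0 <= linfun f @^-1: W)%VS.
  by apply: pointed_coradical_sub => g gG; rewrite -memv_preim lfunE fW.
by move/subvP/(_ _ hH0); rewrite -memv_preim lfunE.
Qed.

Lemma coradicalM : {in H0 &, forall h h', h * h' \in H0}.
Proof.
move=> h h' hH0 h'H0.
have -> : h * h' = amulr h' h by rewrite lfunE.
apply: (coradical_linear_mem _ hH0) => g gG; rewrite /= lfunE /=.
have -> : g * h' = amull g h' by rewrite lfunE.
apply: (coradical_linear_mem _ h'H0) => g' g'G.
by rewrite /= lfunE /= grouplike_coradical // grouplikeM.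
Qed.

Lemma coradical_antipode : {in H0, forall h, antipode h \in H0}.
Proof.
apply: coradical_linear_mem => g gG /=.
by rewrite antipode_grouplike // grouplike_coradical // grouplikeV.
Qed.

Lemma coradical_conj g y : g \in grouplike H ->
  (g * y * g^-1 \in H0) = (y \in H0).
Proof.
move=> gG; have gU := grouplike_unit gG.
have gH0 := grouplike_coradical gG.
have gVH0 := grouplike_coradical (grouplikeV gG).
apply/idP/idP => yH0; last by rewrite !coradicalM.
have -> : y = g^-1 * (g * y * g^-1) * g by rewrite !mulrA mulVr // mul1r mulrVK.
by do 2?apply: coradicalM.
Qed.

(** * Coinvariants of the second term of the coradical filtration *)

(** The map u \ox v |-> u^-1 v for u group-like, extended to all of H \ox H.
    The choice of a projection onto H0 for this extension is immaterial modulo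
    H0 on the image of H1 under the comultiplication, as that image lies in
    the span of the u \ox v with u group-like and of the u \ox h with h in H0,
    and the value on the latter is in H0. *)
Definition untwist_tens : 'Hom(tens H H, H) :=
  linfun (tlift (fun u v => antipode (projv H0 u) * v)).

Lemma untwist_tensE u v :
  untwist_tens (u \ox v) = antipode (projv H0 u) * v.
Proof.
rewrite lfunE /= tliftE => [//|w|w] l y z.
  by rewrite !linearP /= mulrDl scalerAl.
by rewrite mulrDr scalerAr.
Qed.

Definition untwist : 'Hom(H, H) := (untwist_tens \o comul)%VF.

Lemma untwistE m : untwist m = untwist_tens (comul m).
Proof. exact: comp_lfunE. Qed.

(** On tensors with right factor in H0 both terms are in H0. On h \ox v with h
    group-like, (g h)^-1 (g v) = h^-1 v, and the two terms are equal. *)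
Lemma untwist_grouplikeM g m : g \in grouplike H -> m \in H1 ->
  untwist (g * m) - untwist m \in H0.
Proof.
move=> gG; have gU := grouplike_unit gG; have gH0 := grouplike_coradical gG.
have /grouplikeP[_ gg] := gG.
rewrite !untwistE comulM gg /coradical1 -memv_preim; move: (comul m) => t.
pose D := (untwist_tens \o linfun (tmul (g \ox g)) - untwist_tens)%VF.
have DE s : D s = untwist_tens (tmul (g \ox g) s) - untwist_tens s.
  by rewrite add_lfunE opp_lfunE comp_lfunE (lfunE (tmul _)).
rewrite -DE memv_preim; apply/subvP; rewrite subv_add; apply/andP; split.
  apply: tensv_sub => u h _ hH0; rewrite -memv_preim DE tmulE !untwist_tensE.
  by rewrite rpredB // !coradicalM ?coradical_antipode ?memv_proj.
apply: tensv_sub => h v hH0 _; rewrite -memv_preim DE tmulE !untwist_tensE.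
rewrite !projv_id ?coradicalM // mulrA.
have := @coradical_linear_eq _ (amulr g \o antipode \o amull g)%VF antipode.
move/(_ _ h hH0); rewrite /= !comp_lfunE !lfunE /= => -> => [|g' g'G /=].
  by rewrite subrr mem0v.
rewrite !comp_lfunE !lfunE /= !antipode_grouplike ?grouplikeM //.
by rewrite invrM ?grouplike_unit // mulrVK.
Qed.

(** An upper bound, cut out by linear conditions, for the relations that
    are divided out of H1 in k (x)_H0 H1. *)
Definition untwist_relations : {vspace H} :=
  (lker (counit : 'Hom(H, k^o)) :&: untwist @^-1: H0)%VS.

Lemma mem_untwist_relations w :
  (w \in untwist_relations) = (counit w == 0 :> k) && (untwist w \in H0).
Proof. by rewrite memv_cap memv_ker -memv_preim. Qed.

Lemma relation_untwist b m : b \in H0 -> m \in H1 ->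
  counit b *: m - b * m \in untwist_relations.
Proof.
move=> bH0 mH1; pose f u := counit u *: m - u * m.
have f_linear : linear f.
  move=> l u v; rewrite /f linearP /= mulrDl scalerDl scalerBr opprD addrACA.
  by rewrite scalerAl scalerA.
pose fL := HB.pack_for {linear H -> H} f
  (GRing.isLinear.Build k H H *:%R f f_linear).
apply: (@coradical_linear_mem _ fL untwist_relations _ b bH0) => g gG /=.
rewrite /f (grouplike_counit gG) scale1r mem_untwist_relations.
rewrite linearB /= counitM (grouplike_counit gG) mul1r subrr eqxx /=.
by rewrite linearB /= -rpredN opprB untwist_grouplikeM.
Qed.

(** A subspace of H1 that avoids the relations embeds in k (x)_H0 H1, by
    w |-> 1 \ox w; the action of k on H is a retraction of this embedding that
    carries the balancing relations to [untwist_relations]. *)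
Lemma dim_trivial_tensor_ge (W : {vspace H}) :
  (W <= H1)%VS -> (W :&: untwist_relations = 0)%VS ->
  (\dim W <= \dim (trivial_tensor_over H0 H1))%N.
Proof.
move=> WH1 WR; pose one : (k^o : vectType k) := 1.
pose jL := HB.pack_for {linear H -> tens k^o H} (tensor one : H -> tens k^o H)
  (GRing.isLinear.Build k H (tens k^o H) *:%R (tensor one)
     (@tensor_linearr k k^o H one)).
pose j : 'Hom(H, tens k^o H) := linfun jL.
pose q : 'Hom(tens k^o H, H) := linfun (tlift (fun (l : k^o) v => l *: v)).
have qE l v : q (l \ox v) = l *: v.
  rewrite lfunE /= tliftE => [//|u|u] c y z; first by rewrite scalerDl scalerA.
  by rewrite scalerDr !scalerA mulrC.
have jE w : j w = one \ox w by rewrite lfunE.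
have jK : {in W, cancel j q} by move=> w _; rewrite jE qE scale1r.
have relR : (balancing_relations H0 H1 <= q @^-1: untwist_relations)%VS.
  apply: span_set_sub => _ [l [b [m [bH0 mH1 ->]]]].
  rewrite -memv_preim linearB /= !qE -scalerA -scalerBr.
  by rewrite memvZ // relation_untwist.
rewrite /trivial_tensor_over.
set A := tensv _ _; set B := balancing_relations _ _ in relR *.
have jWA : (j @: W <= A)%VS.
  apply/subvP => _ /memv_imgP[w wW ->]; rewrite jE.
  by rewrite mem_tensv ?memvf // (subvP WH1).
have jWB : (j @: W :&: B = 0)%VS.
  apply/eqP; rewrite -subv0; apply/subvP => t /memv_capP[].
  case/memv_imgP=> w wW -> jwB.
  have /(subvP relR) := jwB; rewrite -memv_preim jK // => wR.
  have: w \in (W :&: untwist_relations)%VS by rewrite memv_cap wW.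
  by rewrite WR memv0 => /eqP ->; rewrite linear0 mem0v.
have dimj : \dim (j @: W) = \dim W.
  apply: limg_dim_eq; apply/eqP; rewrite -subv0; apply/subvP => w.
  rewrite memv_cap memv_ker memv0 => /andP[wW /eqP jw].
  by rewrite -(jK w wW) jw linear0.
rewrite -dimj -(leq_add2l (\dim (A :&: B))) [X in (_ <= X)%N]dimv_cap_compl.
rewrite -dimv_disjoint_sum.
  by rewrite dimvS // subv_add capvSl.
by apply/eqP; rewrite -subv0 -jWB capvC capvS // capvSr.
Qed.

(** * Skew primitive elements in rank one *)

Lemma skew_primitive_coradical1 b y : b \in grouplike H ->
  y \in skew_primitive b 1 -> y \in H1.
Proof.
move=> bG /eqP ys; rewrite -memv_preim ys.
by apply: memv_add; rewrite mem_tensv ?memvf ?grouplike_coradical ?grouplike1.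
Qed.

Lemma untwist_skew_primitive b y : b \in grouplike H ->
  y \in skew_primitive b 1 -> untwist y - y \in H0.
Proof.
move=> bG /eqP ys; rewrite untwistE ys linearD /= !untwist_tensE.
have G1 := grouplike1 H.
rewrite (projv_id (grouplike_coradical G1)) (antipode_grouplike G1) invr1 mul1r.
by rewrite addrK coradicalM ?coradical_antipode ?memv_proj ?grouplike_coradical.
Qed.

(** Otherwise the span of 1, x and y has dimension 3 and avoids the relations:
    the map [untwist] detects the coefficients of x and y modulo H0, and then
    the counit, which vanishes on x and y, detects that of 1. *)
Lemma rank1_skew_primitive a b x y : has_rank H 1 ->
    a \in grouplike H -> b \in grouplike H ->
    x \in skew_primitive a 1 -> x \notin H0 -> y \in skew_primitive b 1 ->
  y \in (<[x]> + H0)%VS.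
Proof.
move=> rk1 aG bG xs xH0 ys; apply: contraT => yxH0.
have G1 := grouplike1 H; have oneH0 := grouplike_coradical G1.
have oneH1 : 1 \in H1.
  rewrite -memv_preim comul1; apply: (subvP (addvSl _ _)).
  by rewrite mem_tensv ?memvf.
suff: (3 <= \dim (trivial_tensor_over H0 H1))%N by rewrite rk1.
pose W := span [:: y; x; 1].
have dimW : \dim W = 3%N.
  apply/eqP; rewrite -[_ == _]/(free [:: y; x; 1]) !free_cons.
  rewrite span_seq1 nil_free span_nil memv0 oner_eq0 andbT.
  apply/andP; split.
    apply: contra yxH0; apply/subvP; rewrite span_cons span_seq1.
    by rewrite addvS // -memvE.
  by rewrite andbT; apply: contra xH0; apply/subvP; rewrite -memvE.
rewrite -dimW; apply: dim_trivial_tensor_ge.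
  apply/span_subvP => w; rewrite !inE => /or3P[] /eqP -> //.
    exact: skew_primitive_coradical1 ys.
  exact: skew_primitive_coradical1 xs.
apply/eqP; rewrite -subv0; apply/subvP => w /memv_capP[].
rewrite /W !span_cons span_nil addv0 => /memv_addP[_ /vlineP[r ->] [v]].
case/memv_addP=> _ /vlineP[s ->] [_ /vlineP[t ->] ->] -> {w v}.
rewrite mem_untwist_relations memv0 => /andP[/eqP].
rewrite !linearD !linearZ /= (skew_primitive_counit bG G1 ys).
rewrite (skew_primitive_counit aG G1 xs) counit1 !scaler0 !add0r => t0.
have {t0} -> : t = 0 by rewrite -t0 [t%:A]mulr1.
rewrite !scale0r !addr0 => rsH0.
have {}rsH0 : r *: y + s *: x \in H0.
  have -> : r *: y + s *: x = r *: untwist y + s *: untwist x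
      - (r *: (untwist y - y) + s *: (untwist x - x)).
    by rewrite !scalerBr (addrACA (r *: untwist y)) -opprD subKr.
  apply: rpredB => //; apply: rpredD; apply: memvZ.
    exact: untwist_skew_primitive ys.
  exact: untwist_skew_primitive xs.
have r0 : r = 0.
  apply: contraNeq yxH0 => r0; rewrite -[y](scalerK r0) memvZ //.
  apply/memv_addP; exists (- s *: x); first by rewrite memvZ ?memv_line.
  by exists (r *: y + s *: x); rewrite // scaleNr addrC addrK.
move: rsH0; rewrite r0 scale0r !add0r => sH0.
have [->|s0] := eqVneq s 0; first by rewrite scale0r.
by case/negP: xH0; rewrite -[x](scalerK s0) memvZ.
Qed.

Lemma coradical_cocommutative :
  {in H0, forall h, tswap H H (comul h) = comul h}.
Proof.
move=> h hH0; rewrite -comp_lfunE.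
apply: (coradical_linear_eq _ hH0) => g /grouplikeP[_ gg] /=.
by rewrite comp_lfunE gg tswapE.
Qed.

(** Exchanging the factors in h \ox a + 1 \ox h, which cocommutativity
    allows, gives h \ox (a - 1) = (a - 1) \ox h. *)
Lemma coradical_skew_primitive a h : a != 1 ->
  h \in skew_primitive a 1 -> h \in H0 -> exists c, h = c *: (a - 1).
Proof.
move=> a1 /eqP hs hH0; apply: tensor_comm_prop; last by rewrite subr_eq0.
have := coradical_cocommutative hH0; rewrite hs linearD /= !tswapE => sym_h.
apply/eqP; rewrite tensorBr tensorBl subr_eq addrAC eq_sym subr_eq.
exact/eqP.
Qed.

(** Uniqueness of the skew point, and of its skew primitives up to scalars and
    trivial ones: with y = r x + h, killing H0 in the left factor of comul y
    leaves the class of r x \ox a by the formula for x, and of r x \ox b by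
    that for y, so b = a; then h is a skew primitive in H0. *)
Lemma rank1_skew_primitive_decomp a b x y : has_rank H 1 ->
    a \in grouplike H -> a != 1 -> b \in grouplike H ->
    x \in skew_primitive a 1 -> x \notin H0 ->
    y \in skew_primitive b 1 -> y \notin H0 ->
  b = a /\ exists r c, y = r *: x + c *: (a - 1).
Proof.
move=> rk1 aG a1 bG xs xH0 ys yH0.
have /memv_addP[_ /vlineP[r ->] [h hH0 def_y]] :=
  rank1_skew_primitive rk1 aG bG xs xH0 ys.
have r0 : r != 0 by apply: contraNneq yH0 => r0; rewrite def_y r0 scale0r add0r.
(* Q has kernel H0, so T sends comul z to Q z \ox d for z in P_{d,1}. *)
pose Q : 'Hom(H, H) := (\1 - projv H0)%VF.
have Q0 u : (Q u == 0) = (u \in H0).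
  rewrite add_lfunE opp_lfunE id_lfunE subr_eq0.
  by apply/eqP/idP => [->|/projv_id ->//]; apply: memv_proj.
have QH0 u : u \in H0 -> Q u = 0 by rewrite -Q0 => /eqP.
have H0_1 := grouplike_coradical (grouplike1 H).
pose T : 'Hom(tens H H, tens H H) := linfun (tlift (fun u v => Q u \ox v)).
have TE u v : T (u \ox v) = Q u \ox v.
  rewrite lfunE /= tliftE => [//|w|w] l y' z.
    by rewrite linearP tensorDl tensorZl.
  by rewrite tensorDr tensorZr.
have Ts z d : z \in skew_primitive d 1 -> T (comul z) = Q z \ox d.
  by move=> /eqP ->; rewrite linearD /= !TE (QH0 1) // tensor0l addr0.
have Th : T (comul h) = 0.
  rewrite -comp_lfunE; transitivity ((0 : 'Hom(H, tens H H)) h); last first.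
    exact: zero_lfunE.
  apply: (coradical_linear_eq _ hH0) => g gG /=.
  have /grouplikeP[_ gg] := gG; rewrite comp_lfunE gg TE.
  by rewrite (QH0 g) ?grouplike_coradical // tensor0l zero_lfunE.
have ab : b = a.
  apply/eqP; rewrite -subr_eq0; apply/eqP.
  apply: (@tensor_eq0 _ _ _ (Q y)); last by rewrite Q0.
  rewrite tensorBr -(Ts y b ys) def_y !linearD /= Th (QH0 h hH0) !linearZ /=.
  by rewrite (Ts x a xs) !addr0 tensorZl subrr.
split=> //; have hs : h \in skew_primitive a 1.
  have -> : h = y - r *: x by rewrite def_y addrAC subrr add0r.
  apply/eqP; rewrite linearB linearZ /= (eqP ys) (eqP xs) ab.
  by rewrite tensorBl tensorBr tensorZl tensorZr scalerDr opprD addrACA.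
by have [c ch] := coradical_skew_primitive a1 hs hH0; exists r, c;
  rewrite def_y ch.
Qed.

End Pointed.

(** * The conjugation action *)

Theorem corollary4p3 (k : fieldType) (p : nat) (char_p : p \in [pchar k])
    (H : hopfAlgType k) (H_pointed : pointed H) (H_rank1 : has_rank H 1)
    (H_gen : generated_by_coradical1 H)
    (a : H) (H_third : third_type a)
    (x : H) (x_skew : x \in skew_primitive a 1) (x_notin : x \notin coradical H)
    (x_conj : a * x * a^-1 = x + (a - 1)) :
  exists c : H -> k,
    {in grouplike H &, {morph c : g h / g * h >-> g + h}} /\
    {in grouplike H, forall g, g * x * g^-1 = x + c g *: (a - 1)}.
Proof.
have [[aG _] a1 _] := H_third; have aU := grouplike_unit aG.
have conj1 g : g \in grouplike H ->
    g * a * g^-1 = a /\ exists c, g * x * g^-1 = x + c *: (a - 1).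
  move=> gG; have gU := grouplike_unit gG.
  have gaG : g * a * g^-1 \in grouplike H by rewrite !grouplikeM ?grouplikeV.
  have [||ga [r [c gx]]] :=
    rank1_skew_primitive_decomp H_pointed H_rank1 aG a1 gaG x_skew x_notin
      (y := g * x * g^-1).
  - exact: skew_primitive_conj.
  - by rewrite coradical_conj.
  split=> //; exists c; suff r1 : r = 1 by rewrite gx r1 scale1r.
  have comm_ga : g * a = a * g by rewrite -[LHS](mulrVK gU) ga.
  (* Conjugating x_conj by g gives the same relation for g * x * g^-1. *)
  have : g * (a * x * a^-1) * g^-1 = a * (g * x * g^-1) * a^-1.
    rewrite !mulrA comm_ga -!mulrA; do 3!congr (_ * _).
    by rewrite -!invrM // comm_ga.
  rewrite x_conj mulrDr mulrDl mulrBr mulrBl ga mulr1 mulrV // gx.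
  rewrite mulrDr mulrDl -!scalerAr -!scalerAl x_conj mulrBr mulrBl mulrK //.
  rewrite mulr1 mulrV // (scalerDr r x) addrAC => /addIr/addrI/eqP.
  rewrite -subr_eq0 -{1}[a - 1]scale1r -scalerBl scaler_eq0.
  by rewrite subr_eq0 [_ - 1 == 0]subr_eq0 (negPf a1) orbF => /eqP.
have [c cP] : exists c : H -> k, {in grouplike H, forall g,
    g * x * g^-1 = x + c g *: (a - 1)}.
  have /choice[c cP] g : exists l : k,
      g \in grouplike H -> g * x * g^-1 = x + l *: (a - 1).
    have [gG|gG] := boolP (g \in grouplike H); last by exists 0.
    by have [_ [l lP]] := conj1 g gG; exists l.
  by exists c.
exists c; split=> // g h gG hG;
have [gU hU] := (grouplike_unit gG, grouplike_unit hG).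
have ghG := grouplikeM gG hG; have [ga _] := conj1 g gG.
have: g * h * x * (g * h)^-1 = g * (h * x * h^-1) * g^-1.
  by rewrite invrM // !mulrA.
rewrite !cP // mulrDr mulrDl -scalerAr -scalerAl cP //.
rewrite mulrBr mulrBl ga mulr1 mulrV // -addrA -scalerDl => /addrI/eqP.
rewrite -subr_eq0 -scalerBl scaler_eq0 [a - 1 == 0]subr_eq0 (negPf a1) orbF.
by rewrite subr_eq0 => /eqP.
Qed.
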